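(* Let $w$ be a weight function on $[0,1]$, $\phi w(x)=(1-x)^2w(x)$, and let $f\in L^2(\Omega,w)$ be a function defined on the wedge $\Omega$. Define $$f_e(x):=\tfrac12\big(f(x,1)+f(1,x)\big)\quad\text{and}\quad f_o(x):=\tfrac12\,\frac{f(x,1)-f(1,x)}{1-x}.$$ Then, for $n\ge 1$ and $x_1,x_2\in[0,1]$, $$S_nf(x_1,1)=s_n(w;f_e)(x_1)+(1-x_1)\,s_{n-1}(\phi w;f_o)(x_1),$$ $$S_nf(1,x_2)=s_n(w;f_e)(x_2)-(1-x_2)\,s_{n-1}(\phi w;f_o)(x_2).$$ In particular: if at a point $x\in[0,1)$ one has $s_n(w;f_e)(x)\to f_e(x)$ and $s_n(\phi w;f_o)(x)\to f_o(x)$ as $n\to\infty$, then $S_nf(x,1)\to f(x,1)$ and $S_nf(1,x)\to f(1,x)$; and if $s_n(w;f_e)\to f_e$ uniformly on $[0,1]$ and $s_n(\phi w;f_o)\to f_o$ uniformly on $[0,1)$, then $S_nf\to f$ uniformly on $\Omega$.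
   Context: $\Omega=\{(x_1,1):x_1\in[0,1]\}\cup\{(1,x_2):x_2\in[0,1]\}$. A weight function on $[0,1]$ is a nonnegative measurable function with all moments finite and with positive integral. For a weight $v$ on $[0,1]$, $p_n(v;\cdot)$ is an orthogonal polynomial of degree exactly $n$ with respect to $v$ on $[0,1]$, $h_n(v)=\int_0^1|p_n(v;x)|^2v(x)\,dx$, and for $g\in L^2(v)$ the $n$-th partial sum of its Fourier orthogonal expansion is $$s_n(v;g)(x)=\sum_{k=0}^n\widehat g_k(v)\,p_k(v;x),\qquad \widehat g_k(v)=\frac1{h_k(v)}\int_0^1 g(y)p_k(v;y)v(y)\,dy.$$ Define $\langle f,g\rangle_w=\int_0^1 f(x,1)g(x,1)w(x)\,dx+\int_0^1 f(1,y)g(1,y)w(y)\,dy$; $L^2(\Omega,w)$ is the space of measurable functions on $\Omega$ with $\langle f,f\rangle_w<\infty$. Put $$P_n(x,y)=p_n(w;x)+p_n(w;y)-p_n(w;1),\qquad Q_n(x,y)=(1-x)p_{n-1}(\phi w;x)-(1-y)p_{n-1}(\phi w;y)\quad(n\ge1),$$ which together with the constant $1$ are mutually orthogonal, and $$S_nf=\frac{\langle f,1\rangle_w}{\langle1,1\rangle_w}+\sum_{k=1}^n\left[\frac{\langle f,P_k\rangle_w}{\langle P_k,P_k\rangle_w}P_k+\frac{\langle f,Q_k\rangle_w}{\langle Q_k,Q_k\rangle_w}Q_k\right].$$ *)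

(* Defs.v *)
From HB Require Import structures.
From mathcomp Require Import all_boot all_order all_algebra.
From mathcomp Require Import all_classical all_reals all_analysis.

Set Implicit Arguments.
Unset Strict Implicit.
Unset Printing Implicit Defensive.

Import Order.TTheory GRing.Theory Num.Theory.
Import numFieldNormedType.Exports.

Local Open Scope classical_set_scope.
Local Open Scope ring_scope.

Section Defs.
Context {R : realType}.
Implicit Types (v w : R -> R) (g : R -> R) (f : R * R -> R).
Implicit Types (p q : nat -> {poly R}).

Notation mu := (@lebesgue_measure R).
Notation I01 := (`[0 : R, 1 : R]%classic).

Definition Omega : set (R * R) :=
  [set z | exists2 x, x \in `[0, 1] & z = (x, 1) \/ z = (1, x)].

Record is_weight w : Prop := IsWeight {
  weight_ge0 : forall x, x \in `[0, 1] -> 0 <= w x ;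
  weight_measurable : measurable_fun I01 w ;
  weight_moments : forall n,
    mu.-integrable I01 (EFin \o (fun x => x ^+ n * w x)) ;
  weight_gt0 : 0 < \int[mu]_(x in I01) w x }.

Record is_orthopoly v p : Prop := IsOrthopoly {
  orthopoly_size : forall n, size (p n) = n.+1 ;
  orthopoly_orth : forall n (r : {poly R}), (size r <= n)%N ->
    \int[mu]_(x in I01) ((p n).[x] * r.[x] * v x) = 0 }.

Definition hnorm v p n : R :=
  \int[mu]_(x in I01) (`|(p n).[x]| ^+ 2 * v x).

Definition fourier_coef v p g n : R :=
  (hnorm v p n)^-1 * \int[mu]_(x in I01) (g x * (p n).[x] * v x).

Definition fourier_sum v p n g (x : R) : R :=
  \sum_(k < n.+1) fourier_coef v p g k * (p k).[x].

Definition wedge_dot w (f1 f2 : R * R -> R) : R :=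
  \int[mu]_(x in I01) (f1 (x, 1) * f2 (x, 1) * w x) +
  \int[mu]_(y in I01) (f1 (1, y) * f2 (1, y) * w y).

(* [wedge_dot w f f] cannot express finiteness, since real-valued integrals are
   0 when they diverge; hence the extended-real integrals here. *)
Definition wedge_L2 w f : Prop :=
  measurable_fun Omega f /\
  (\int[mu]_(x in I01) (f (x, 1%R) * f (x, 1%R) * w x)%:E +
   \int[mu]_(y in I01) (f (1%R, y) * f (1%R, y) * w y)%:E < +oo)%E.

Definition phiw w (x : R) : R := (1 - x) ^+ 2 * w x.

(* In the next three definitions, [p] stands for the orthogonal polynomials of
   the weight [w] and [q] for those of [phiw w]. *)
Definition wedgeP p n (z : R * R) : R :=
  (p n).[z.1] + (p n).[z.2] - (p n).[1].

Definition wedgeQ q n (z : R * R) : R :=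
  (1 - z.1) * (q n.-1).[z.1] - (1 - z.2) * (q n.-1).[z.2].

Definition wedge_sum w p q n f (z : R * R) : R :=
  wedge_dot w f (cst 1) / wedge_dot w (cst 1) (cst 1) +
  \sum_(1 <= k < n.+1)
    (wedge_dot w f (wedgeP p k) / wedge_dot w (wedgeP p k) (wedgeP p k) *
       wedgeP p k z +
     wedge_dot w f (wedgeQ q k) / wedge_dot w (wedgeQ q k) (wedgeQ q k) *
       wedgeQ q k z).

Definition f_even f (x : R) : R := 2^-1 * (f (x, 1) + f (1, x)).

(* At x = 1 this is the junk value 0, because 0^-1 = 0. *)
Definition f_odd f (x : R) : R := 2^-1 * ((f (x, 1) - f (1, x)) / (1 - x)).

End Defs.

(* Main.v *)
Require Import Defs.
From HB Require Import structures.
From mathcomp Require Import all_boot all_order all_algebra.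
From mathcomp Require Import all_classical all_reals all_analysis.
From mathcomp Require Import measurable_realfun ring lra.

Set Implicit Arguments.
Unset Strict Implicit.
Unset Printing Implicit Defensive.

Import Order.TTheory GRing.Theory Num.Theory.
Import numFieldNormedType.Exports.

Local Open Scope classical_set_scope.
Local Open Scope ring_scope.

(** Restricted to either side of the wedge, a function of the span of the P_n
    and Q_n is a one-variable polynomial: both sides see P_n as p_n, while Q_n
    is (1 - x) q_(n-1)(x) on one side and its opposite on the other.  So P_n is
    symmetric and Q_n antisymmetric under the exchange of the two sides.
    Pairing f with P_n therefore only sees the symmetric part f_e of f, and
    pairing with Q_n only its antisymmetric part, which is (1 - x) f_o(x); of
    the two factors 1 - x so produced, one comes from f and one from Q_n, and
    together they turn the weight w into (1 - x)^2 w.  The numerators and the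
    squared norms are both doubled because there are two sides, so each wedge
    coefficient is exactly a one-variable Fourier coefficient ([wedge_coefP],
    [wedge_coefQ]); the constant term matches the k = 0 term because p_0 is a
    nonzero constant ([wedge_coef1]).  Summing gives the two formulas
    ([wedge_sum_left], [wedge_sum_right]).

    The analytic content is that all the integrals can be split and added: f
    restricted to a side is square integrable for w, and so are polynomials,
    hence their products are integrable for w ([integrable_L2_poly_weight]).

    For convergence, f satisfies the same decomposition as its partial sums,
    namely f_e + (1 - x) f_o on one side and f_e - (1 - x) f_o on the other.
    The error on the wedge is thus at most the error for f_e plus 1 - x <= 1
    times the error for f_o.  At the corner the factor 1 - x vanishes, which is
    why convergence for f_o on [0, 1) is enough to get it on the whole wedge. *)

(** * Uniform convergence as a distance estimate *)

Section UniformConvergence.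
Context {R : realType}.

Lemma uniform_cvg_distP (U : choiceType) (A : set U) (F : nat -> U -> R)
    (f : U -> R) :
  {uniform A, F n @[n --> \oo] --> f} <->
  forall e, 0 < e -> \forall n \near \oo, forall x, A x -> `|f x - F n x| < e.
Proof.
split=> [Ff e e0|Ff].
  apply: (Ff [set h | forall y, A y -> `|f y - h y| < e]).
  apply/uniform_nbhs; exists [set uv | ball uv.1 e uv.2].
  by split => //; rewrite -entourage_ballE; exists e.
move=> P /uniform_nbhs[E []]; rewrite -entourage_ballE => -[e /= e0 eE] EP.
by apply: filterS (Ff e e0) => n Fn; apply: EP => y Ay; apply: eE; exact: Fn.
Qed.

End UniformConvergence.

(** * Integrability against a weight *)

Section WeightedIntegrals.
Context {R : realType}.
Notation mu := (@lebesgue_measure R).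
Notation I01 := (`[0 : R, 1 : R]%classic).
Implicit Types (w g : R -> R) (r : {poly R}).

Lemma integrable_poly_weight w r : is_weight w ->
  mu.-integrable I01 (EFin \o (fun x => r.[x] * w x)).
Proof.
move=> hw.
have mI : measurable (I01 : set (measurableTypeR R)) by exact: measurable_itv.
have : mu.-integrable I01
    (fun x => \sum_(i <- index_enum 'I_(size r))
       (r`_i)%:E * (x ^+ i * w x)%R%:E)%E.
  apply: integrable_sum => // i _.
  exact: (integrableZl mI r`_i (weight_moments hw i)).
apply: eq_integrable => // x _ /=.
rewrite horner_coef mulr_suml -sumEFin; apply: eq_bigr => i _.
by rewrite -EFinM mulrA.
Qed.

(** The Cauchy-Schwarz argument in its pointwise form: the integrand is
    dominated by [(g ^+ 2 + r ^+ 2) * w]. *)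
Lemma integrable_L2_poly_weight w g r : is_weight w ->
  measurable_fun I01 g ->
  (\int[mu]_(x in I01) (g x * g x * w x)%:E < +oo)%E ->
  mu.-integrable I01 (EFin \o (fun x => g x * r.[x] * w x)).
Proof.
move=> hw mg g2.
have mI : measurable (I01 : set (measurableTypeR R)) by exact: measurable_itv.
have mw := weight_measurable hw.
have w0 x : I01 x -> 0 <= w x by exact: weight_ge0.
have ig2 : mu.-integrable I01 (EFin \o (fun x => g x * g x * w x)).
  apply/integrableP; split.
    by apply/measurable_EFinP; do 2!apply: measurable_funM => //.
  rewrite (@eq_integral _ (measurableTypeR R) R mu I01
    (fun x => (g x * g x * w x)%:E)) // => x /set_mem Ix /=.
  by rewrite ger0_norm // mulr_ge0 ?w0 // -expr2 sqr_ge0.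
have ir2 := integrable_poly_weight (r ^+ 2) hw.
apply: le_integrable (integrableD mI ig2 ir2) => //.
  apply/measurable_EFinP; apply: measurable_funM => //.
  by apply: measurable_funM => //; exact: measurable_poly.
move=> x Ix /=; rewrite lee_fin horner_exp -mulrDl !normrM (ger0_norm (w0 x Ix)).
apply: ler_wpM2r; first exact: w0.
rewrite -normrM; apply: le_trans (ler_norm _).
by rewrite ler_norml; apply/andP; split; nra.
Qed.

(** The two sides of the wedge contribute [g1] and [g2], and [f_even]
    and [(1 - x) * f_odd] are the half sum and half difference of the two sides:
    this is where the factor 2 of the wedge coefficients comes from. *)
Lemma Rintegral_half_sum (g1 g2 g : R -> R) :
  mu.-integrable I01 (EFin \o g1) -> mu.-integrable I01 (EFin \o g2) ->
  (forall x, g x = 2^-1 * (g1 x + g2 x)) ->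
  \int[mu]_(x in I01) g1 x + \int[mu]_(x in I01) g2 x =
  2 * \int[mu]_(x in I01) g x.
Proof.
move=> i1 i2 gE.
have mI : measurable (I01 : set (measurableTypeR R)) by exact: measurable_itv.
have -> : g = fun x => 2^-1 * (g1 x + g2 x) by exact/funext.
rewrite RintegralZl //; last exact: (integrableD mI i1 i2).
by rewrite RintegralD // mulrA divff // mul1r.
Qed.

End WeightedIntegrals.

(** * Expansions on the wedge *)

Section WedgeExpansion.
Context {R : realType}.
Notation mu := (@lebesgue_measure R).
Notation I01 := (`[0 : R, 1 : R]%classic).
Variables (w : R -> R) (p q : nat -> {poly R}) (f : R * R -> R).

(** Measurability of a function on a set only says something when that set is
    itself measurable, so this is needed to exploit [measurable_fun Omega f]. *)
Lemma measurable_Omega : measurable (@Omega R).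
Proof.
rewrite (_ : Omega = (I01 `*` [set 1]) `|` ([set 1] `*` I01)).
  by apply: measurableU; apply: measurableX => //; exact: measurable_itv.
apply/seteqP; split => -[a b].
  by case=> x x01 [] [-> ->]; [left|right].
by case=> -[/= h1 h2]; [exists a|exists b]; rewrite ?h1 ?h2 //; [left|right].
Qed.

Lemma measurable_Omega_sides : measurable_fun Omega f ->
  measurable_fun I01 (fun x => f (x, 1)) /\
  measurable_fun I01 (fun x => f (1, x)).
Proof.
move=> mf; split.
- apply: (@measurable_comp _ _ _ _ _ _ _ f _ (fun x : R => (x, 1))
    measurable_Omega) => //.
    by move=> _ [x x01 <-]; exists x => //; left.
  by apply: measurable_funTS; exact: measurable_fun_pair.
- apply: (@measurable_comp _ _ _ _ _ _ _ f _ (fun x : R => (1, x))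
    measurable_Omega) => //.
    by move=> _ [x x01 <-]; exists x => //; right.
  by apply: measurable_funTS; exact: measurable_fun_pair.
Qed.

Hypotheses (hw : is_weight w) (hf : wedge_L2 w f).

Lemma integrable_wedge_L2_sides (r : {poly R}) :
  mu.-integrable I01 (EFin \o (fun x => f (x, 1) * r.[x] * w x)) /\
  mu.-integrable I01 (EFin \o (fun x => f (1, x) * r.[x] * w x)).
Proof.
case: hf => /measurable_Omega_sides[m1 m2] foo.
have sq0 g : (0 <= \int[mu]_(x in I01) (g x * g x * w x)%:E)%E.
  apply: integral_ge0 => x x01; rewrite lee_fin mulr_ge0 //.
    by rewrite -expr2 sqr_ge0.
  exact: weight_ge0.
split; apply: integrable_L2_poly_weight => //; apply: le_lt_trans foo.
- by rewrite leeDl // (sq0 (fun x => f (1, x))).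
- by rewrite leeDr // (sq0 (fun x => f (x, 1))).
Qed.

Lemma wedgeP_left n x : wedgeP p n (x, 1) = (p n).[x].
Proof. by rewrite /wedgeP /= addrK. Qed.

Lemma wedgeP_right n x : wedgeP p n (1, x) = (p n).[x].
Proof. by rewrite /wedgeP /= addrAC subrr add0r. Qed.

Lemma wedgeQ_left n x : wedgeQ q n (x, 1) = (1 - x) * (q n.-1).[x].
Proof. by rewrite /wedgeQ /= subrr mul0r subr0. Qed.

Lemma wedgeQ_right n x : wedgeQ q n (1, x) = - ((1 - x) * (q n.-1).[x]).
Proof. by rewrite /wedgeQ /= subrr mul0r sub0r. Qed.

(** At [x = 1] both sides vanish, since the two arguments of [f] coincide at the
    corner; so the identity is pointwise and no null set has to be removed
    from the integrals. *)
Lemma f_odd_mul (x : R) : f_odd f x * (1 - x) = 2^-1 * (f (x, 1) - f (1, x)).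
Proof.
rewrite /f_odd; have [->|x1] := eqVneq x 1; first by rewrite !subrr !mulr0.
by rewrite -mulrA divfK // subr_eq0 eq_sym.
Qed.

Lemma wedge_dot_even (r : {poly R}) (g : R * R -> R) :
  (forall x, g (x, 1) = r.[x]) -> (forall x, g (1, x) = r.[x]) ->
  wedge_dot w f g = 2 * \int[mu]_(x in I01) (f_even f x * r.[x] * w x).
Proof.
move=> gl gr; have [i1 i2] := integrable_wedge_L2_sides r.
rewrite -(Rintegral_half_sum i1 i2); last by move=> x; rewrite /f_even; ring.
by congr (_ + _); apply: eq_Rintegral => x _; rewrite ?gl ?gr.
Qed.

Lemma wedge_coefP k :
  wedge_dot w f (wedgeP p k) / wedge_dot w (wedgeP p k) (wedgeP p k) =
  fourier_coef w p (f_even f) k.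
Proof.
have -> : wedge_dot w (wedgeP p k) (wedgeP p k) = 2 * hnorm w p k.
  rewrite mulr_natl mulr2n; congr (_ + _); apply: eq_Rintegral => x _;
  by rewrite ?wedgeP_left ?wedgeP_right real_normK ?num_real // expr2.
rewrite (wedge_dot_even (wedgeP_left k) (wedgeP_right k)) -mulf_div divff //.
by rewrite mul1r mulrC.
Qed.

Lemma wedge_coefQ k :
  wedge_dot w f (wedgeQ q k) / wedge_dot w (wedgeQ q k) (wedgeQ q k) =
  fourier_coef (phiw w) q (f_odd f) k.-1.
Proof.
have -> : wedge_dot w (wedgeQ q k) (wedgeQ q k) = 2 * hnorm (phiw w) q k.-1.
  rewrite mulr_natl mulr2n; congr (_ + _); apply: eq_Rintegral => x _;
  rewrite ?wedgeQ_left ?wedgeQ_right real_normK ?num_real // /phiw; ring.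
(* One factor [1 - x] goes into the polynomial [r]; the other one is supplied
   by [f_odd], whose denominator it cancels. *)
pose r := (1 - 'X) * q k.-1.
have rE x : r.[x] = (1 - x) * (q k.-1).[x] by rewrite /r !hornerE.
have [i1 _] := integrable_wedge_L2_sides r.
have [_ i2] := integrable_wedge_L2_sides (- r).
suff -> : wedge_dot w f (wedgeQ q k) =
    2 * \int[mu]_(x in I01) (f_odd f x * (q k.-1).[x] * phiw w x).
  by rewrite -mulf_div divff // mul1r mulrC.
rewrite -(Rintegral_half_sum i1 i2).
  by congr (_ + _); apply: eq_Rintegral => x _;
    rewrite ?wedgeQ_left ?wedgeQ_right ?hornerN rE.
move=> x; rewrite hornerN rE /phiw.
have -> : f_odd f x * (q k.-1).[x] * ((1 - x) ^+ 2 * w x) =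
  (f_odd f x * (1 - x)) * ((1 - x) * (q k.-1).[x] * w x) by ring.
rewrite f_odd_mul; ring.
Qed.

Hypothesis hp : is_orthopoly w p.

(** The constant function is proportional to [wedgeP p 0], and an orthogonal
    projection onto a line does not depend on the vector spanning it. *)
Lemma wedge_coef1 x :
  wedge_dot w f (cst 1) / wedge_dot w (cst 1) (cst 1) =
  fourier_coef w p (f_even f) 0 * (p 0).[x].
Proof.
have mI : measurable (I01 : set (measurableTypeR R)) by exact: measurable_itv.
have /size_poly1P[c c0 pE] : size (p 0%N) == 1%N by rewrite (orthopoly_size hp).
have [i1 i2] := integrable_wedge_L2_sides 1.
have iw := integrable_poly_weight 1 hw.
have fP0 : wedge_dot w f (wedgeP p 0) = c * wedge_dot w f (cst 1).
  rewrite /wedge_dot mulrDr -!RintegralZl //; last 2 first.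
  - by apply: eq_integrable i2 => // y _ /=; rewrite hornerE.
  - by apply: eq_integrable i1 => // y _ /=; rewrite hornerE.
  by congr (_ + _); apply: eq_Rintegral => y _;
    rewrite ?wedgeP_left ?wedgeP_right pE hornerC /=; ring.
have P0P0 : wedge_dot w (wedgeP p 0) (wedgeP p 0) =
    c ^+ 2 * wedge_dot w (cst 1) (cst 1).
  have i11 : mu.-integrable I01 (EFin \o (fun x => 1 * 1 * w x)).
    by apply: eq_integrable iw => // y _ /=; rewrite hornerE mulr1.
  rewrite /wedge_dot mulrDr -!RintegralZl //.
  by congr (_ + _); apply: eq_Rintegral => y _;
    rewrite ?wedgeP_left ?wedgeP_right pE hornerC /=; ring.
rewrite -wedge_coefP fP0 P0P0 pE hornerC invfM.
by move: (wedge_dot w f _) (wedge_dot w _ _)^-1 => a b; field.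
Qed.

(** The point [z] lies on one of the sides, with parameter [x]; [s] is the sign
    that the antisymmetric functions [wedgeQ q k] take there. *)
Lemma wedge_sum_fourier n z x s :
  (forall k, wedgeP p k z = (p k).[x]) ->
  (forall k, wedgeQ q k z = s * ((1 - x) * (q k.-1).[x])) ->
  wedge_sum w p q n.+1 f z = fourier_sum w p n.+1 (f_even f) x +
    s * ((1 - x) * fourier_sum (phiw w) q n (f_odd f) x).
Proof.
move=> Pz Qz; rewrite /wedge_sum big_split /= (wedge_coef1 x) addrA.
rewrite /fourier_sum !big_add1 !big_mkord [in RHS]big_ord_recl /=.
congr (_ + _ + _).
  by apply: eq_bigr => k _; rewrite wedge_coefP Pz.
by rewrite !mulr_sumr; apply: eq_bigr => k _; rewrite wedge_coefQ Qz /=; ring.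
Qed.

Lemma wedge_sum_left n x :
  wedge_sum w p q n.+1 f (x, 1) = fourier_sum w p n.+1 (f_even f) x +
    (1 - x) * fourier_sum (phiw w) q n (f_odd f) x.
Proof.
rewrite (@wedge_sum_fourier _ _ x 1) ?mul1r // => k; first exact: wedgeP_left.
by rewrite wedgeQ_left mul1r.
Qed.

Lemma wedge_sum_right n x :
  wedge_sum w p q n.+1 f (1, x) = fourier_sum w p n.+1 (f_even f) x -
    (1 - x) * fourier_sum (phiw w) q n (f_odd f) x.
Proof.
rewrite (@wedge_sum_fourier _ _ x (-1)) ?mulN1r // => k.
  exact: wedgeP_right.
by rewrite wedgeQ_right mulN1r.
Qed.

Lemma wedge_left_even_odd x : f (x, 1) = f_even f x + (1 - x) * f_odd f x.
Proof. by rewrite [_ * f_odd _ _]mulrC f_odd_mul /f_even; field. Qed.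

Lemma wedge_right_even_odd x : f (1, x) = f_even f x - (1 - x) * f_odd f x.
Proof. by rewrite [_ * f_odd _ _]mulrC f_odd_mul /f_even; field. Qed.

Lemma wedge_sum_cvg x :
  fourier_sum w p n (f_even f) x @[n --> \oo] --> f_even f x ->
  fourier_sum (phiw w) q n (f_odd f) x @[n --> \oo] --> f_odd f x ->
  (wedge_sum w p q n f (x, 1) @[n --> \oo] --> f (x, 1)) /\
  (wedge_sum w p q n f (1, x) @[n --> \oo] --> f (1, x)).
Proof.
move=> ecvg ocvg; rewrite wedge_left_even_odd wedge_right_even_odd.
split; rewrite -cvg_shiftS /=.
- rewrite (eq_cvg _ _ (fun n => wedge_sum_left n x)).
  apply: cvgD; first by rewrite (cvg_shiftS (fun n => fourier_sum w p n _ x)).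
  by apply: cvgM => //; exact: cvg_cst.
- rewrite (eq_cvg _ _ (fun n => wedge_sum_right n x)).
  apply: cvgB; first by rewrite (cvg_shiftS (fun n => fourier_sum w p n _ x)).
  by apply: cvgM => //; exact: cvg_cst.
Qed.

(** The error for [f_odd] enters multiplied by [1 - x], which is at most 1 and
    vanishes at the corner, so that a bound on it over [0, 1) controls both
    sides of the wedge up to the corner. *)
Lemma wedge_error_lt n x e : x \in `[0, 1] ->
  `|f_even f x - fourier_sum w p n.+1 (f_even f) x| < e / 2 ->
  (x \in `[0, 1[ ->
    `|f_odd f x - fourier_sum (phiw w) q n (f_odd f) x| < e / 2) ->
  `|f (x, 1) - wedge_sum w p q n.+1 f (x, 1)| < e /\
  `|f (1, x) - wedge_sum w p q n.+1 f (1, x)| < e.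
Proof.
rewrite wedge_left_even_odd wedge_right_even_odd wedge_sum_left wedge_sum_right.
set a := f_even f x; set b := f_odd f x.
set a' := fourier_sum w _ _ _ _; set b' := fourier_sum (phiw w) _ _ _ _.
rewrite in_itv /= => /andP[x0 x1] ha hb.
have hb' : `|(1 - x) * (b - b')| < e / 2.
  move: x1; rewrite le_eqVlt => /orP[/eqP x1|x1].
    by rewrite x1 subrr mul0r normr0; apply: le_lt_trans ha.
  rewrite normrM ger0_norm ?subr_ge0 ?ltW //.
  have := hb; rewrite in_itv /= x0 x1 => /(_ isT); apply: le_lt_trans.
  by rewrite ler_piMl ?gerBl.
have eE : e = e / 2 + e / 2 by field.
split; rewrite [X in _ < X]eE.
- have -> : a + (1 - x) * b - (a' + (1 - x) * b') =
    (a - a') + (1 - x) * (b - b') by ring.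
  by apply: le_lt_trans (ler_normD _ _) _; rewrite ltrD.
- have -> : a - (1 - x) * b - (a' - (1 - x) * b') =
    (a - a') - (1 - x) * (b - b') by ring.
  by apply: le_lt_trans (ler_normB _ _) _; rewrite ltrD.
Qed.

Lemma wedge_sum_uniform_cvg :
  {uniform `[0, 1], fourier_sum w p n (f_even f) @[n --> \oo] --> f_even f} ->
  {uniform `[0, 1[, fourier_sum (phiw w) q n (f_odd f) @[n --> \oo]
                      --> f_odd f} ->
  {uniform Omega, wedge_sum w p q n f @[n --> \oo] --> f}.
Proof.
move=> /uniform_cvg_distP ecvg /uniform_cvg_distP ocvg.
apply/uniform_cvg_distP => e e0; have e20 : 0 < e / 2 by rewrite divr_gt0.
have [N1 _ hN1] := ecvg _ e20; have [N2 _ hN2] := ocvg _ e20.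
(* The extra one absorbs the shift between the degrees [n.+1] and [n] of the
   partial sums for [f_even] and [f_odd]. *)
exists (maxn N1 N2).+1 => //= -[//|n] /=.
rewrite ltnS geq_max => /andP[n1 n2] z [x x01 zE].
have [eL eR] := wedge_error_lt x01 (hN1 n.+1 (leqW n1) x x01)
  (fun x01 => hN2 n n2 x x01).
by case: zE => ->.
Qed.

End WedgeExpansion.

Theorem theorem2p4 (R : realType) (w : R -> R) (p q : nat -> {poly R})
    (f : R * R -> R) (hw : is_weight w) (hp : is_orthopoly w p)
    (hq : is_orthopoly (phiw w) q) (hf : wedge_L2 w f) :
  [/\ forall n : nat, (1 <= n)%N ->
        (forall x1 : R, x1 \in `[0, 1] ->
           wedge_sum w p q n f (x1, 1) =
           fourier_sum w p n (f_even f) x1 +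
           (1 - x1) * fourier_sum (phiw w) q n.-1 (f_odd f) x1) /\
        (forall x2 : R, x2 \in `[0, 1] ->
           wedge_sum w p q n f (1, x2) =
           fourier_sum w p n (f_even f) x2 -
           (1 - x2) * fourier_sum (phiw w) q n.-1 (f_odd f) x2),
      forall x : R, x \in `[0, 1[ ->
        fourier_sum w p n (f_even f) x @[n --> \oo] --> f_even f x ->
        fourier_sum (phiw w) q n (f_odd f) x @[n --> \oo] --> f_odd f x ->
        (wedge_sum w p q n f (x, 1) @[n --> \oo] --> f (x, 1)) /\
        (wedge_sum w p q n f (1, x) @[n --> \oo] --> f (1, x))
    & {uniform `[0, 1], fourier_sum w p n (f_even f) @[n --> \oo]
                          --> f_even f} ->
      {uniform `[0, 1[, fourier_sum (phiw w) q n (f_odd f) @[n --> \oo]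
                          --> f_odd f} ->
      {uniform Omega, wedge_sum w p q n f @[n --> \oo] --> f}].
Proof.
split.
- case=> // n _; split=> x _; [exact: wedge_sum_left | exact: wedge_sum_right].
- by move=> x _; exact: wedge_sum_cvg.
- exact: wedge_sum_uniform_cvg.
Qed.
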